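(* Let $L>0$, let $a$ satisfy (H_a), $g\in L^2(0,L)$, and let $\phi$ satisfy (H_φ) with $\phi(0)=+\infty$. Assume there is $M>0$ with $g(x)\ge -M$ for a.e. $x\in(0,L)$. Then problem (P) has no weak solution.
   Context: (H_a): $a\in L^\infty(0,L)$ and there are constants $0<\alpha<\beta$ with $\alpha\le a(x)\le\beta$ for a.e. $x\in(0,L)$. (H_φ): $\phi:\mathbb{R}\to\mathbb{R}\cup\{+\infty\}$ is continuous when $\mathbb{R}\cup\{+\infty\}$ carries its usual topology (neighbourhoods of $+\infty$ contain some $(M,+\infty]$), and $\phi(s)<+\infty$ for every $s\neq 0$. A weak solution of problem (P) with data $(a,g,\phi)$ is a function $u$ with $u\in H^1_0(0,L)$, $\phi(u)\in L^2(0,L)$, and $-\frac{d}{dx}(a\frac{du}{dx})=-\frac{d\phi(u)}{dx}-\frac{dg}{dx}$ in $\mathcal D'(0,L)$. *)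

(* Defs.v *)
From HB Require Import structures.
From mathcomp Require Import all_boot all_order all_algebra.
From mathcomp Require Import all_classical all_reals all_analysis.
From mathcomp Require Import measurable_realfun.
Set Implicit Arguments. Unset Strict Implicit. Unset Printing Implicit Defensive.
Import Order.TTheory GRing.Theory Num.Theory.
Import numFieldNormedType.Exports.
Local Open Scope classical_set_scope.
Local Open Scope ring_scope.

Section Defs.
Variable R : realType.
Local Notation mu := (@lebesgue_measure R).

Definition Iv (L : R) : set R := `]0, L[%classic.

Definition test_fun (L : R) (psi : R -> R) : Prop :=
  (forall (n : nat) (x : R), derivable (derive1n n psi) x 1) /\
  exists c d : R, 0 < c /\ d < L /\ forall x, (x < c \/ d < x) -> psi x = 0.

Definition L2 (L : R) (f : R -> R) : Prop :=
  measurable_fun (Iv L) f /\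
  (\int[mu]_(x in Iv L) ((f x) ^+ 2)%:E < +oo)%E.

Definition L2e (L : R) (f : R -> \bar R) : Prop :=
  measurable_fun (Iv L) f /\
  (\int[mu]_(x in Iv L) (f x * f x) < +oo)%E.

Definition H1 (L : R) (u w : R -> R) : Prop :=
  L2 L u /\ L2 L w /\
  forall psi, test_fun L psi ->
    Rintegral mu (Iv L) (fun x => u x * (derive1 psi) x) =
    - Rintegral mu (Iv L) (fun x => w x * psi x).

Definition H10 (L : R) (u w : R -> R) : Prop :=
  H1 L u w /\
  exists psi : nat -> R -> R, (forall n, test_fun L (psi n)) /\
    (fun n => Rintegral mu (Iv L) (fun x => (psi n x - u x) ^+ 2)
            + Rintegral mu (Iv L) (fun x => (derive1 (psi n) x - w x) ^+ 2))
      @ \oo --> 0.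

(* weak solution of (P) with data (a, g, phi):
   u in H^1_0, phi(u) in L^2, and
   -(a u')' = -(phi(u))' - g'  in D'(0,L), i.e.
   forall psi in D(0,L),  int a u' psi' = int (phi(u) + g) psi'. *)
Definition weak_solution (L : R) (a g : R -> R) (phi : R -> \bar R)
    (u : R -> R) : Prop :=
  exists w : R -> R,
    H10 L u w /\
    L2e L (fun x => phi (u x)) /\
    forall psi, test_fun L psi ->
      Rintegral mu (Iv L) (fun x => a x * w x * derive1 psi x) =
      Rintegral mu (Iv L) (fun x => (fine (phi (u x)) + g x) * derive1 psi x).

End Defs.

(* Main.v *)
(**
  With h := a u' - phi(u) - g, the equation says that h is a constant C almost
  everywhere (du Bois-Reymond). As phi = +oo at 0 and g >= -M, there is
  delta > 0 such that a u' = C + phi(u) + g > 0, i.e. u' > 0, a.e. where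
  |u| < delta. But for u in H^1_0 and theta(s) = max(0, delta - |s|) the
  integral of theta(u) u' vanishes, being that of the derivative of
  Theta(u) with Theta' = theta. Hence |u| >= delta a.e., which contradicts the
  boundary condition: the mean of u^2 over (0, e) is O(e) for u in H^1_0.
*)
Require Import Defs.
From HB Require Import structures.
From mathcomp Require Import all_boot all_order all_algebra.
From mathcomp Require Import all_classical all_reals all_analysis.
From mathcomp Require Import measurable_realfun.
From mathcomp Require Import ring lra.
Set Implicit Arguments. Unset Strict Implicit. Unset Printing Implicit Defensive.
Import Order.TTheory GRing.Theory Num.Theory.
Import numFieldNormedType.Exports.
Local Open Scope classical_set_scope.
Local Open Scope ring_scope.

(** Membership of [u] in H^1_0 is given only as approximability by test functions, so no pointwise
    value of [u] is available. Each fact about [u] is therefore an identity for a test function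
    [psi], obtained from the fundamental theorem of calculus and the vanishing of [psi] at 0 and L,
    then carried over to [u] by an explicit error estimate. The bound |u| >= delta comes from a
    clash of signs: theta(u) u' is nonnegative with integral zero, hence zero a.e., while both
    factors are positive wherever |u| < delta. The du Bois-Reymond argument needs concrete
    C^infinity functions with compact support in (0, L), rich enough to approximate indicators of
    initial intervals; products of functions of type e^{-1/x} supply them. *)

Section FlatFunctions.
Context {R : realType}.

(** Each derivative of e^{-1/x}, extended by 0 to x <= 0, is a combination of the functions x^{-k}
    e^{-1/x}. Carrying the index [k] makes the family stable under differentiation. *)
Definition flat (k : nat) (x : R) : R :=
  if 0 < x then x^-1 ^+ k * expR (- x^-1) else 0.

Lemma flat_ge0 k x : 0 <= flat k x.
Proof.
rewrite /flat; case: ifPn => // x0.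
by rewrite mulr_ge0 ?expR_ge0// exprn_ge0// invr_ge0 ltW.
Qed.

(** With y = 1/x this is y^{k+2} <= (k+2)! e^y, read off the exponential series. The square on the
    right makes the difference quotient at 0 an O(|h|), which settles the only delicate point of
    [is_derive_flat]. *)
Lemma flat_quadratic k (x : R) : flat k x <= k.+2`!%:R * x ^+ 2.
Proof.
rewrite /flat; case: ifPn => [x0|_]; last by rewrite mulr_ge0// sqr_ge0.
have y0 : 0 < x^-1 by rewrite invr_gt0.
have f0 : 0 < k.+2`!%:R :> R by rewrite ltr0n fact_gt0.
have : x^-1 ^+ k.+2 <= k.+2`!%:R * expR x^-1.
  rewrite mulrC -ler_pdivrMr// (le_trans _ (expR_ge1Dxn k.+1 (ltW y0)))//.
  by rewrite lerDr.
rewrite -addn2 exprD expRN addn2 => h.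
rewrite ler_pdivrMr ?expR_gt0// mulrAC.
by rewrite -ler_pdivrMr ?exprn_gt0// -exprVn.
Qed.

Lemma is_derive_flat k (x : R) :
  is_derive x 1 (flat k) (flat k.+2 x - k%:R * flat k.+1 x).
Proof.
have [x0|x0|->] := ltgtP x 0.
- rewrite {2 3}/flat ltNge (ltW x0)/= mulr0 subr0.
  have e : {near x, cst 0 =1 flat k}.
    near=> y; rewrite /flat ifF//; apply/negbTE; rewrite -leNgt ltW//.
    by near: y; exact: lt_nbhsl.
  by apply: (near_eq_is_derive e).
- have e : {near x, (fun y => y^-1 ^+ k * expR (- y^-1)) =1 flat k}.
    near=> y; rewrite /flat ifT//.
    by near: y; exact: lt_nbhsr.
  apply: (near_eq_is_derive e).
  have xn0 : x != 0 by rewrite gt_eqF.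
  have dV : is_derive x 1 (fun y : R => y^-1) (- x ^- 2).
    apply: is_derive_eq; first exact: (@is_deriveV R id _ _ _ xn0).
    by rewrite /GRing.scale/= mulr1.
  have dE : is_derive x 1 (fun y : R => expR (- y^-1)) (expR (- x^-1) * x ^- 2).
    have dN := is_deriveN dV; rewrite opprK in dN.
    exact: (@is_derive1_comp R expR (- (fun y : R => y^-1)) _ _ _
      (is_derive_expR (- x^-1)) dN).
  have := is_deriveX k dV; rewrite exprfctE => dX.
  have dP := is_deriveM dX dE. rewrite mulrfctE in dP; apply: (is_derive_eq dP).
  rewrite /flat x0 /GRing.scale/=.
  by case: k {e dX dP} => [|k]/=; rewrite ?exprS; field.
- rewrite /flat ltxx mulr0 subr0.
  suff h : h^-1 *: (flat k (h + 0) - flat k 0) @[h --> 0^'] --> (0 : R).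
    apply: DeriveDef.
      apply/cvg_ex; exists 0; move: h; apply: cvg_trans.
      by apply: near_eq_cvg; near=> h; rewrite /= [h *: 1]mulr1.
    rewrite -derive1E; exact/cvg_lim.
  pose C : R := k.+2`!%:R.
  have c0 : C * `|h| @[h --> (0 : R)^'] --> (0 : R).
    have : {for (0 : R), continuous (fun h : R => C * `|h|)}.
      by apply: continuousM; [exact: cst_continuous|exact: norm_continuous].
    by rewrite /prop_for /continuous_at normr0 mulr0; exact: cvg_within_filter.
  apply: (@squeeze_cvgr _ _ _ _ (fun h : R => - (C * `|h|)) (fun h => C * `|h|)).
  + near=> h.
    have h0 : h != 0 by near: h; exact: nbhs_dnbhs_neq.
    rewrite -ler_norml addr0 [flat k 0]/flat ltxx subr0 normrM normfV.
    rewrite mulrC ler_pdivrMr ?normr_gt0// -mulrA -normrM -expr2.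
    by rewrite !ger0_norm ?sqr_ge0 ?flat_ge0// flat_quadratic.
  + by rewrite -[X in _ --> X]oppr0; exact: cvgN.
  + exact: c0.
Unshelve. all: by end_near. Qed.

(** A class of functions closed under differentiation, hence made of smooth functions. *)
Inductive flat_alg : (R -> R) -> Prop :=
| flat_alg_flat k a b : flat_alg (fun x => flat k (a * x + b))
| flat_alg_add f g : flat_alg f -> flat_alg g -> flat_alg (fun x => f x + g x)
| flat_alg_scale c f : flat_alg f -> flat_alg (fun x => c * f x)
| flat_alg_mul f g : flat_alg f -> flat_alg g -> flat_alg (fun x => f x * g x).

Lemma flat_alg_is_derive f : flat_alg f ->
  exists2 f', flat_alg f' & forall x : R, is_derive x 1 f (f' x).
Proof.
elim=> {f} [k a b|f g _ [f' af df] _ [g' ag dg]|c f _ [f' af df]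
  |f g Af [f' af df] Ag [g' ag dg]].
- exists (fun x : R => a * (flat k.+2 (a * x + b) + (- k%:R) * flat k.+1 (a * x + b))).
    apply: flat_alg_scale; apply: flat_alg_add; first exact: flat_alg_flat.
    by apply: flat_alg_scale; exact: flat_alg_flat.
  move=> x.
  have da : is_derive x 1 (fun y : R => a * y + b) a.
    have := is_deriveD (is_deriveZ a (is_derive_id x 1)) (is_derive_cst b x 1).
    by rewrite addr0 /GRing.scale/= mulr1.
  have h := @is_derive1_comp R (flat k) (fun y : R => a * y + b) _ _ _ (is_derive_flat k _) da.
  by apply: (is_derive_eq h); ring.
- exists (fun x : R => f' x + g' x); first exact: flat_alg_add.
  by move=> x; exact: is_deriveD.
- exists (fun x : R => c * f' x); first exact: flat_alg_scale.
  by move=> x; exact: (is_deriveZ c (df x)).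
- exists (fun x : R => f x * g' x + g x * f' x).
    by apply: flat_alg_add; apply: flat_alg_mul.
  by move=> x; exact: (is_deriveM (df x) (dg x)).
Qed.

Lemma flat_alg_derivable n f : flat_alg f -> forall x : R, derivable (derive1n n f) x 1.
Proof.
move=> af x; suff : flat_alg (derive1n n f).
  by move=> /flat_alg_is_derive[f' _ /(_ x)[]].
elim: n => [//|n /flat_alg_is_derive[f' af' df']].
rewrite derive1nS (_ : derive1 _ = f')//; apply/funext => y.
by rewrite derive1E; have [_ ->] := df' y.
Qed.
End FlatFunctions.

(** * Fundamental theorem of calculus and primitives of compactly supported functions *)

Section Antiderivative.
Context {R : realType}.
Local Notation mu := (@lebesgue_measure R).
Implicit Types (f F : R -> R) (c d : R).

Lemma Rintegral_support f (A : set R) :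
  (forall x, f x != 0 -> A x) ->
  Rintegral mu A f = Rintegral mu setT f.
Proof.
move=> h; rewrite Rintegral_mkcond; congr Rintegral; apply/funext => x.
rewrite patchE; case: ifPn => //; rewrite notin_setE => nAx.
by apply/esym/eqP; apply: contra_notT nAx => /h.
Qed.

Lemma integrable_continuous f (a b : R) b0 b1 : continuous f ->
  mu.-integrable [set` Interval (BSide b0 a) (BSide b1 b)] (EFin \o f).
Proof.
move=> cf; have : mu.-integrable `[a, b] (EFin \o f).
  apply: continuous_compact_integrable; first exact: segment_compact.
  exact: continuous_subspaceT.
by apply: integrableS => //; apply: subset_itv; [case: b0|case: b1]; rewrite bnd_simp.
Qed.

Lemma is_derive_continuous F f : (forall x : R, is_derive x 1 F (f x)) -> continuous F.
Proof. by move=> dF x; apply/differentiable_continuous/derivable1_diffP; case: (dF x). Qed.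

Lemma Rintegral_derive F f (a b : R) : a < b ->
  (forall x : R, is_derive x 1 F (f x)) -> continuous f ->
  Rintegral mu `]a, b[ f = F b - F a.
Proof.
move=> ab dF cf; have cF := is_derive_continuous dF.
rewrite Rintegral_itv_obnd_cbnd; last exact: integrable_continuous.
rewrite Rintegral_itv_bndo_bndc; last exact: integrable_continuous.
rewrite /Rintegral (@continuous_FTC2 R f F)//.
- exact: continuous_subspaceT.
- split=> [x _||]; first by case: (dF x).
    by apply: cvg_at_right_filter; exact: cF.
  by apply: cvg_at_left_filter; exact: cF.
- by move=> x _; rewrite derive1E; case: (dF x).
Qed.

(** Vanishing outside [c, d] makes [f] integrable on the whole line, so the primitive can start at
    -oo. It serves twice: to build test functions, and as the Theta with Theta' = theta. *)
Lemma is_derive_Rintegral f (c d : R) : continuous f ->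
  (forall x, x < c \/ d < x -> f x = 0) ->
  forall x : R, is_derive x 1 (fun y => Rintegral mu `]-oo, y] f) (f x).
Proof.
move=> cf f0 x.
have fi : mu.-integrable setT (EFin \o f).
  have : mu.-integrable setT ((EFin \o f) \_ `[c, d]).
    by rewrite -integrable_mkcond//; exact: integrable_continuous.
  apply: eq_integrable => // y _; rewrite patchE; case: ifPn => //.
  rewrite notin_setE /= in_itv/= => /negP; rewrite negb_and -!ltNge => /orP h.
  by rewrite f0.
have x1 : x < x + 1 by rewrite ltrDl.
have fi1 : mu.-integrable `]-oo, x + 1] (EFin \o f) by exact: integrableS fi.
have := continuous_FTC1 x1 fi1; rewrite ltNyr => /(_ isT (cf x))[dF F'].
by apply: DeriveDef; [exact: dF|rewrite -derive1E; exact: F'].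
Qed.

(** The primitive from -oo vanishes left of [c] because [f] does, and right of [d] because the total
    integral is zero; its higher derivatives are those of [f]. *)
Lemma test_fun_antiderivative (L : R) f : flat_alg f ->
  (exists c d : R, 0 < c /\ d < L /\ forall x, (x < c \/ d < x) -> f x = 0) ->
  Rintegral mu (Iv L) f = 0 ->
  exists2 psi, test_fun L psi & derive1 psi = f.
Proof.
move=> af [c [d [c0 [dL f0]]]] If.
have [f' _ df] := flat_alg_is_derive af.
have dF := is_derive_Rintegral (is_derive_continuous df) f0.
exists (fun y => Rintegral mu `]-oo, y] f); last first.
  by apply/funext => x; rewrite derive1E; case: (dF x).
split=> [n x|].
  case: n => [|n]; first by case: (dF x).
  rewrite /derive1n iterSr (_ : derive1 _ = f); first exact: flat_alg_derivable.
  by apply/funext => y; rewrite derive1E; case: (dF y).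
exists c, d; split => //; split => // x [xc|dx].
  rewrite (@eq_Rintegral _ _ _ _ _ (cst 0)) => [|y].
    by rewrite Rintegral_cst ?mul0r//; exact: measurable_itv.
  rewrite inE/= in_itv/= => yx.
  by apply: f0; left; exact: le_lt_trans xc.
rewrite Rintegral_support => [|y fy].
  rewrite -If; apply/esym/Rintegral_support => y fy; rewrite /Iv/= in_itv/=.
  have [cy|cy] := leP c y; last by rewrite f0 ?eqxx// in fy; left.
  have [dy|dy] := leP y d; last by rewrite f0 ?eqxx// in fy; right.
  by rewrite (lt_le_trans c0)//= (le_lt_trans dy).
rewrite /= in_itv/=.
by have [//|dy] := leP y x; rewrite f0 ?eqxx// in fy; right; exact: lt_trans dy.
Qed.
End Antiderivative.

(** * Dominated convergence and smooth approximation of indicators *)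

Section AbstractIntegralTools.
Context d (T : measurableType d) {R : realType} (mu : {measure set T -> \bar R}).
Implicit Types (h f : T -> R).

Lemma integrable_mulr_bounded (D : set T) h f B : measurable D ->
  mu.-integrable D (EFin \o h) -> measurable_fun D f ->
  (forall x, D x -> `|f x| <= B) ->
  mu.-integrable D (EFin \o (fun x => h x * f x)).
Proof.
move=> mD hi mf fB.
have mh : measurable_fun D h by apply/measurable_EFinP; exact: measurable_int hi.
apply: (le_integrable mD _ _ (integrableZl mD B hi)).
  by apply/measurable_EFinP; exact: measurable_funM.
move=> x Dx /=; rewrite lee_fin !normrM mulrC ler_wpM2r//.
by rewrite (le_trans (fB x Dx))// ler_norm.
Qed.

Lemma Rintegral_dominated (D : set T) (f B : T -> R) (b : nat -> T -> R) : measurable D ->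
  mu.-integrable D (EFin \o B) ->
  (forall n, measurable_fun D (b n)) ->
  (forall x, D x -> b n x @[n --> \oo] --> f x) ->
  (forall n x, D x -> `|b n x| <= B x) ->
  Rintegral mu D (b n) @[n --> \oo] --> Rintegral mu D f.
Proof.
move=> mD Bi mb bf bB.
have mf : measurable_fun D f.
  by apply: (measurable_fun_cvg mb).
have fB x : D x -> `|f x| <= B x.
  move=> Dx; have c : `|b n x| @[n --> \oo] --> `|f x| by apply: cvg_norm; exact: bf.
  rewrite -(cvg_lim _ c)//; apply: limr_le; first by apply/cvg_ex; eexists; exact: c.
  by near=> n; exact: bB.
have fi : mu.-integrable D (EFin \o f).
  apply: (le_integrable mD _ _ Bi); first exact/measurable_EFinP.
  by move=> x Dx /=; rewrite lee_fin (le_trans (fB x Dx))// ler_norm.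
apply: fine_cvg; rewrite fineK; last exact: integrable_fin_num.
apply: (@dominated_cvg _ _ _ mu D mD _ _ (EFin \o B)) => //.
- by move=> n; exact/measurable_EFinP.
- move=> x Dx; apply: cvg_EFin; first by near=> n.
  exact: bf.
Unshelve. all: by end_near. Qed.

End AbstractIntegralTools.

Section IntegralTools.
Context {R : realType}.
Local Notation mu := (@lebesgue_measure R).
Implicit Types (L : R) (f h : R -> R).

Lemma measurable_Iv L : measurable (Iv L : set (measurableTypeR R)).
Proof. exact: measurable_itv. Qed.

Lemma measurable_continuous f (D : set R) : continuous f -> measurable_fun D f.
Proof. by move=> cf; apply: measurable_funTS; exact: continuous_measurable_fun. Qed.

Lemma continuous_bounded L f : 0 < L -> continuous f ->
  exists B, forall x, Iv L x -> `|f x| <= B.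
Proof.
move=> L0 cf; have [|c _ fc] := @EVT_max R (fun x => `|f x|) 0 L (ltW L0).
  by apply: continuous_subspaceT => x; apply: cvg_norm; exact: cf.
exists `|f c| => x xL; apply: fc.
by move: xL; rewrite /Iv/= !in_itv/= => /andP[/ltW -> /ltW ->].
Qed.

Lemma integrable_mulr_continuous L h f : 0 < L ->
  mu.-integrable (Iv L) (EFin \o h) -> continuous f ->
  mu.-integrable (Iv L) (EFin \o (fun x => h x * f x)).
Proof.
move=> L0 hi cf; have [B fB] := continuous_bounded L0 cf.
apply: (integrable_mulr_bounded (B := B)) => //; first exact: measurable_Iv.
exact: measurable_continuous.
Qed.

Lemma flat0_dist (y : R) : 0 < y -> `|flat 0 y - 1| <= y^-1.
Proof.
move=> y0; rewrite /flat y0 expr0 mul1r distrC ger0_norm.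
  by rewrite lerBlDr addrC -lerBlDr; exact: expR_ge1Dx.
by rewrite subr_ge0 expR_le1 oppr_le0 invr_ge0 ltW.
Qed.

Lemma flat0_norm_le1 (y : R) : `|flat 0 y| <= 1.
Proof.
rewrite ger0_norm ?flat_ge0// /flat; case: ifPn => // y0.
by rewrite expr0 mul1r expR_le1 oppr_le0 invr_ge0 ltW.
Qed.

Lemma cvg_flat0_affine (a b : R) : 0 < a ->
  flat 0 (n.+1%:R * a + b) @[n --> \oo] --> (1 : R).
Proof.
move=> a0; apply/cvgrPdist_le => e e0; near=> n.
have h : e^-1 <= n.+1%:R * a + b.
  rewrite -lerBlDr -ler_pdivrMr//.
  apply: (@le_trans _ _ n%:R); last by rewrite ler_nat.
  by near: n; exact: nbhs_infty_ger.
have h0 : 0 < n.+1%:R * a + b by rewrite (lt_le_trans _ h)// invr_gt0.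
by rewrite distrC (le_trans (flat0_dist h0))// invf_ple// posrE.
Unshelve. all: by end_near. Qed.

(** Tends to the indicator of [x < d] on [0 < x], with support in [1/(n+1), d]. *)
Definition plateau (d : R) (n : nat) (x : R) : R :=
  flat 0 (n.+1%:R * x + (-1)) * flat 0 (- n.+1%:R * x + n.+1%:R * d).

(** The support condition is that of [test_fun], but smoothness is recorded as membership in
    [flat_alg], the form that [test_fun_antiderivative] requires. *)
Definition flat_test L f := flat_alg f /\
  exists c d : R, 0 < c /\ d < L /\ forall x, (x < c \/ d < x) -> f x = 0.

Lemma flat_test_plateau L d n : d < L -> flat_test L (plateau d n).
Proof.
move=> dL; split; first by apply: flat_alg_mul; exact: flat_alg_flat.
exists n.+1%:R^-1, d; rewrite invr_gt0 ltr0n; split=> //; split=> // x.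
have n0 : 0 < n.+1%:R :> R by rewrite ltr0n.
rewrite /plateau /flat mulrC; case=> [xn|dx].
  rewrite [X in _ * X]ifF ?mulr0//; apply/negbTE.
  by rewrite -leNgt subr_le0 mulrC -ler_pdivlMr// mul1r ltW.
rewrite ifF ?mul0r//; apply/negbTE.
by rewrite -leNgt mulNr addrC subr_le0 ler_pM2l// ltW.
Qed.

Lemma cvg_plateau d x : 0 < x ->
  plateau d n x @[n --> \oo] --> (if x < d then 1 else 0 : R).
Proof.
move=> x0; case: ifPn => [xd|]; last first.
  rewrite -leNgt => dx; rewrite (_ : (fun n => _) = cst 0); first exact: cvg_cst.
  apply/funext => n; rewrite /plateau [flat 0 (- _ * x + _)]/flat ifF ?mulr0//.
  by apply/negbTE; rewrite -leNgt mulNr addrC subr_le0 ler_pM2l// ltr0n.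
rewrite -[X in _ --> X](mulr1 1); apply: cvgM; first exact: cvg_flat0_affine.
rewrite (_ : (fun n => _) = fun n : nat => flat 0 (n.+1%:R * (d - x) + 0)).
  by apply: cvg_flat0_affine; rewrite subr_gt0.
by apply/funext => n; congr flat; ring.
Qed.

Lemma flat_alg_continuous f : flat_alg f -> continuous f.
Proof. by move=> /flat_alg_is_derive[f' _ /is_derive_continuous]. Qed.

(** The plateaus are flat tests bounded by 1 that converge on (0, L) to the indicator of (0, d);
    dominated convergence with bound |h| passes to the limit. *)
Lemma Rintegral_initial_eq0 L h : 0 < L -> mu.-integrable (Iv L) (EFin \o h) ->
  (forall f, flat_test L f -> Rintegral mu (Iv L) (fun x => h x * f x) = 0) ->
  forall d, 0 < d < L -> Rintegral mu (Iv d) h = 0.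
Proof.
move=> L0 hi h0 d /andP[d0 dL].
have mh : measurable_fun (Iv L) h by apply/measurable_EFinP; exact: measurable_int hi.
have : Rintegral mu (Iv L) (fun x => h x * plateau d n x) @[n --> \oo] -->
    Rintegral mu (Iv L) (h \_ (Iv d)).
  apply: (@Rintegral_dominated _ _ _ mu (Iv L) (h \_ (Iv d)) (fun x => `|h x|)
    (fun n x => h x * plateau d n x)); first exact: measurable_Iv.
  - exact: integrable_norm hi.
  - move=> n; apply: measurable_funM => //; apply: measurable_continuous.
    by apply: flat_alg_continuous; case: (flat_test_plateau n dL).
  - move=> x; rewrite /Iv/= in_itv/= => /andP[x0 xL].
    rewrite patchE (_ : (x \in _) = (x < d)); last first.
      by apply/idP/idP; rewrite inE /= in_itv/= x0.
    have := @cvg_plateau d x x0; case: ifP => xd c.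
      by rewrite -[X in _ --> X]mulr1; apply: cvgMr.
    by rewrite -[X in _ --> X](mulr0 (h x)); apply: cvgMr.
  - move=> n x _; rewrite normrM ler_piMr// /plateau normrM.
    by rewrite mulr_ile1// flat0_norm_le1.
rewrite (_ : (fun n => _) = cst 0); last first.
  by apply/funext => n; apply: h0; exact: flat_test_plateau.
move=> /cvg_lim; rewrite lim_cst// => /(_ (@Rhausdorff R)) ->.
rewrite -Rintegral_mkcondr; congr Rintegral; apply/seteqP; split=> x; rewrite /Iv/= !in_itv/=.
  by move=> /andP[-> xd]; split => //; rewrite (lt_trans xd).
by case.
Qed.
End IntegralTools.

(** * The du Bois-Reymond lemma *)

Section DuBoisReymond.
Context {R : realType}.
Local Notation mu := (@lebesgue_measure R).
Implicit Types (L : R) (f h : R -> R).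

Lemma ae_imply (P Q : R -> Prop) : (forall x, P x -> Q x) ->
  {ae mu, forall x, P x} -> {ae mu, forall x, Q x}.
Proof. by move=> PQ; apply: filterS; first exact: (ae_filter_ringOfSetsType mu). Qed.

Lemma ae_imply2 (P Q S : R -> Prop) : (forall x, P x -> Q x -> S x) ->
  {ae mu, forall x, P x} -> {ae mu, forall x, Q x} -> {ae mu, forall x, S x}.
Proof. by move=> PQ; apply: filterS2; first exact: (ae_filter_ringOfSetsType mu). Qed.

Lemma ae_conj (P Q : R -> Prop) : {ae mu, forall x, P x} ->
  {ae mu, forall x, Q x} -> {ae mu, forall x, P x /\ Q x}.
Proof. by apply: ae_imply2. Qed.

(** Lebesgue differentiation: the derivative of the primitive of [h] is [h] a.e., and on the open
    interval (0, L) this primitive is identically zero. *)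
Lemma ae_eq0_Iv L h : 0 < L -> mu.-integrable (Iv L) (EFin \o h) ->
  (forall d, 0 < d < L -> Rintegral mu (Iv d) h = 0) ->
  {ae mu, forall x, Iv L x -> h x = 0}.
Proof.
move=> L0 hi h0.
have Ki : mu.-integrable setT (EFin \o (h \_ (Iv L))).
  by rewrite -restrict_EFin -integrable_mkcond//; exact: measurable_Iv.
have KiS y : mu.-integrable `]-oo, y] (EFin \o (h \_ (Iv L))).
  by apply: integrableS Ki.
have := FTC1Ny KiS (integrable_locally (measurable_Iv L) hi).
apply: ae_imply => x [_ F'] xL; move: (xL); rewrite /Iv/= in_itv/= => /andP[x0 xL'].
rewrite patchE mem_set// in F'; rewrite -F' derive1E.
rewrite (@near_eq_derive _ _ _ _ (cst 0)) ?derive_cst//.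
have : nbhs x (Iv L) by apply: open_nbhs_nbhs; split => //; exact: interval_open.
apply: filterS => y yL; rewrite /=.
move: (yL); rewrite /Iv/= in_itv/= => /andP[y0 yL'].
apply: (etrans _ (h0 y _)); last by rewrite y0.
rewrite -Rintegral_mkcondr.
rewrite (_ : _ `&` _ = `]0, y]%classic).
  rewrite -Rintegral_itv_bndo_bndc//.
  apply: integrableS hi => //; first exact: measurable_Iv.
  by move=> z; rewrite /Iv/= !in_itv/= => /andP[-> zy]; rewrite (lt_trans zy).
apply/seteqP; split=> z; rewrite /Iv/= !in_itv/=; first by case=> -> /andP[->].
by move=> /andP[-> zy]; rewrite zy (le_lt_trans zy).
Qed.

(** No bump is integrated explicitly: if all flat tests had integral zero, [Rintegral_initial_eq0]
    applied to the constant 1 would give L / 2 = 0. *)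
Lemma exists_flat_test L : 0 < L -> exists2 f, flat_test L f & Rintegral mu (Iv L) f != 0.
Proof.
move=> L0; apply: contrapT => nex.
have L2 : 0 < L / 2 < L by rewrite divr_gt0//= ltr_pdivrMr// ltr_pMr// ltr1n.
have e : Rintegral mu (Iv (L / 2)) (cst 1) = L / 2.
  rewrite Rintegral_cst; last exact: measurable_Iv.
  rewrite -[fine _]/(fine (mu (Iv (L / 2)))).
  have -> : mu (Iv (L / 2)) = (L / 2)%:E.
    by rewrite /Iv lebesgue_measure_itv/= lte_fin; case/andP: L2 => -> _; rewrite sube0.
  by rewrite mul1r.
suff : L / 2 = 0 by apply/eqP; rewrite gt_eqF// divr_gt0.
rewrite -e; apply: (@Rintegral_initial_eq0 R L (cst 1) L0 _ _ _ L2).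

  by apply: integrable_continuous; exact: cst_continuous.
move=> f ft; under eq_Rintegral do rewrite mul1r.
by apply/eqP/negP => /negP f0; apply: nex; exists f.
Qed.

Lemma du_bois_reymond L h : 0 < L -> mu.-integrable (Iv L) (EFin \o h) ->
  (forall psi, test_fun L psi -> Rintegral mu (Iv L) (fun x => h x * derive1 psi x) = 0) ->
  exists C, {ae mu, forall x, Iv L x -> h x = C}.
Proof.
move=> L0 hi h0; have [rho [arho [c1 [d1 [c10 [d1L rho0]]]]] rhon0] := exists_flat_test L0.
(* The only possible value: testing h = C against [rho] gives this quotient. *)
pose C := Rintegral mu (Iv L) (fun x => h x * rho x) / Rintegral mu (Iv L) rho.
exists C.
have mL := measurable_Iv L.
have Ci : mu.-integrable (Iv L) (EFin \o cst C).
  by apply: integrable_continuous; exact: cst_continuous.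
have hCi : mu.-integrable (Iv L) (EFin \o (fun x => h x - C)).
  by have := integrableB mL hi Ci; apply: eq_integrable.
have : {ae mu, forall x, Iv L x -> h x - C = 0}.
  apply: ae_eq0_Iv => //; apply: Rintegral_initial_eq0 => // f [af [c [d [c0 [dL f0]]]]].
  (* Subtracting [m * rho] from [f] makes the integral zero, so [chi] is the derivative of a test
     function and the hypothesis on [h] applies to it. *)
  pose m := Rintegral mu (Iv L) f / Rintegral mu (Iv L) rho.
  pose chi x := f x + (- m) * rho x.
  have achi : flat_alg chi by apply: flat_alg_add => //; exact: flat_alg_scale.
  have cf := flat_alg_continuous af; have crho := flat_alg_continuous arho.
  have fi : mu.-integrable (Iv L) (EFin \o f) by exact: integrable_continuous.
  have rhoi : mu.-integrable (Iv L) (EFin \o rho) by exact: integrable_continuous.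
  have hfi := integrable_mulr_continuous L0 hi cf.
  have hrhoi := integrable_mulr_continuous L0 hi crho.
  have [||psi tpsi psi'] := @test_fun_antiderivative R L chi achi.
  - exists (Num.min c c1), (Num.max d d1).
    rewrite lt_min c0 gt_max dL; split => //; split => // x xcd.
    rewrite /chi f0 ?rho0 ?mulr0 ?addr0//.
      by case: xcd => [|]; [rewrite lt_min => /andP[_]; left|rewrite gt_max => /andP[_]; right].
    by case: xcd => [|]; [rewrite lt_min => /andP[+ _]; left|rewrite gt_max => /andP[+ _]; right].
  - rewrite RintegralD//; last by have := integrableZl mL (- m) rhoi; apply: eq_integrable.
    by rewrite RintegralZl// mulNr /m divfK// subrr.
  have := h0 _ tpsi; rewrite psi' /chi.
  under eq_Rintegral do rewrite mulrDr [h _ * (_ * _)]mulrCA.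
  rewrite RintegralD//; last by have := integrableZl mL (- m) hrhoi; apply: eq_integrable.
  rewrite RintegralZl// => e.
  under eq_Rintegral do rewrite mulrBl.
  rewrite RintegralB//; last by have := integrableZl mL C fi; apply: eq_integrable.
  rewrite RintegralZl// -[RHS]e; congr (_ + _).
  by rewrite mulNr /m /C mulrAC [_ / _ * _]mulrC mulrA.
apply: ae_imply => x xh /xh /eqP; rewrite subr_eq0 => /eqP //.
Qed.
End DuBoisReymond.

(** * Algebra of integrable and square integrable functions *)

Section IntegrableAlgebra.
Context d (T : measurableType d) {R : realType} (mu : {measure set T -> \bar R}).
Variables (D : set T) (mD : measurable D).
Implicit Types (f g : T -> R).
Let int f := mu.-integrable D (EFin \o f).

Lemma integrable_funD f g : int f -> int g -> int (fun x => f x + g x).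
Proof. by move=> fi gi; have := integrableD mD fi gi; apply: eq_integrable. Qed.

Lemma integrable_funB f g : int f -> int g -> int (fun x => f x - g x).
Proof. by move=> fi gi; have := integrableB mD fi gi; apply: eq_integrable. Qed.

Lemma integrable_funZ c f : int f -> int (fun x => c * f x).
Proof. by move=> fi; have := integrableZl mD c fi; apply: eq_integrable. Qed.

Lemma integrable_mul_sqr f g : measurable_fun D f -> measurable_fun D g ->
  int (fun x => f x ^+ 2) -> int (fun x => g x ^+ 2) -> int (fun x => f x * g x).
Proof.
move=> mf mg fi gi; apply: (le_integrable mD _ _ (integrable_funD fi gi)).
  by apply/measurable_EFinP; exact: measurable_funM.
move=> x Dx /=; rewrite lee_fin [leRHS]ger0_norm ?addr_ge0 ?sqr_ge0//.
by rewrite ler_norml; apply/andP; split; nra.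
Qed.
End IntegrableAlgebra.

Section SquareIntegrable.
Context {R : realType}.
Local Notation mu := (@lebesgue_measure R).
Implicit Types (L : R) (f g h : R -> R).
Local Notation int L f := (mu.-integrable (Iv L) (EFin \o f)).

Lemma L2P L f : L2 L f <-> measurable_fun (Iv L) f /\ int L (fun x => f x ^+ 2).
Proof.
split=> [[mf fi]|[mf /integrableP[_ fi]]]; split => //.
  apply/integrableP; split.
    by apply/measurable_EFinP; exact: measurable_funX.
  by under eq_integral do rewrite /= ger0_norm ?sqr_ge0//.
by under eq_integral do rewrite -[_ ^+ 2]ger0_norm ?sqr_ge0//.
Qed.

Lemma L2_sqr L f : L2 L f -> int L (fun x => f x ^+ 2).
Proof. by case/L2P. Qed.

Lemma L2_mul L f g : L2 L f -> L2 L g -> int L (fun x => f x * g x).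
Proof.
move=> /L2P[mf fi] /L2P[mg gi]; apply: integrable_mul_sqr => //; exact: measurable_Iv.
Qed.

Lemma L2_continuous L f : continuous f -> L2 L f.
Proof.
move=> cf; apply/L2P; split; first exact: measurable_continuous.
by apply: integrable_continuous => x; apply: continuousM; exact: cf.
Qed.

Lemma L2_integrable L f : L2 L f -> int L f.
Proof.
move=> fi; have := L2_mul fi (L2_continuous L (@cst_continuous _ _ (1 : R))).
by apply: eq_integrable => [|x _ /=]; [exact: measurable_Iv|rewrite mulr1].
Qed.

Lemma L2B L f g : L2 L f -> L2 L g -> L2 L (fun x => f x - g x).
Proof.
move=> f2 g2; have [mf fi] := (L2P L f).1 f2; have [mg gi] := (L2P L g).1 g2.
apply/L2P; split; first exact: measurable_funB.
have mL := @measurable_Iv R L.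
have := integrable_funD mL (integrable_funB mL fi (integrable_funZ mL 2 (L2_mul f2 g2))) gi.
by apply: eq_integrable => // x _ /=; congr EFin; ring.
Qed.

Lemma L2_mul_bounded L f h B : L2 L f -> measurable_fun (Iv L) h ->
  (forall x, Iv L x -> `|h x| <= B) -> L2 L (fun x => h x * f x).
Proof.
move=> /L2P[mf fi] mh hB; apply/L2P; split; first exact: measurable_funM.
have := @integrable_mulr_bounded _ _ R mu (Iv L) (fun x => f x ^+ 2)
  (fun x => h x ^+ 2) (B ^+ 2) (@measurable_Iv R L) fi.
move=> i; have {i} := i (measurable_funX 2 mh); rewrite -/(int L _) => i.
have {i} : int L (fun x => f x ^+ 2 * h x ^+ 2).
  apply: i => x Lx; rewrite normrX lerXn2r ?nnegrE//; first by rewrite (le_trans _ (hB x Lx)).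
  exact: hB.
by apply: eq_integrable => [|x _ /=]; [exact: measurable_Iv|rewrite exprMn mulrC].
Qed.
End SquareIntegrable.

(** * Vanishing of the integral of theta(u) u' on H^1_0 *)

Section H10.
Context {R : realType}.
Local Notation mu := (@lebesgue_measure R).
Implicit Types (L : R) (f g h u w : R -> R).
Local Notation int L f := (mu.-integrable (Iv L) (EFin \o f)).

Lemma test_fun_is_derive L (psi : R -> R) : test_fun L psi ->
  forall x : R, is_derive x 1 psi (derive1 psi x).
Proof.
by move=> [h _] x; apply: DeriveDef; [exact: (h 0%N x)|rewrite derive1E].
Qed.

Lemma test_fun_continuous L (psi : R -> R) : test_fun L psi -> continuous psi.
Proof. by move=> /test_fun_is_derive/is_derive_continuous. Qed.

Lemma test_fun_continuous_derive1 L (psi : R -> R) : test_fun L psi ->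
  continuous (derive1 psi).
Proof.
move=> [h _]; apply: (@is_derive_continuous R _ (derive1 (derive1 psi))) => x.
by apply: DeriveDef; [exact: (h 1%N x)|rewrite derive1E].
Qed.

Lemma test_fun_boundary L (psi : R -> R) : test_fun L psi -> psi 0 = 0 /\ psi L = 0.
Proof. by move=> [_ [c [d [c0 [dL h]]]]]; split; apply: h; [left|right]. Qed.

Lemma H10_approx L u w (e : R) : H10 L u w -> 0 < e ->
  exists2 psi, test_fun L psi &
    Rintegral mu (Iv L) (fun x => (psi x - u x) ^+ 2) +
    Rintegral mu (Iv L) (fun x => (derive1 psi x - w x) ^+ 2) <= e.
Proof.
move=> [_ [psi [tpsi /cvgrPdist_le/(_ e)]]] c e0; have [N _ /(_ N (leqnn N))] := c e0.
rewrite sub0r normrN => h; exists (psi N) => //; apply: le_trans h; exact: ler_norm.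
Qed.

(** A crude Young inequality. The weight lets a squared approximation error of size eta^2 contribute
    only eta, while the fixed terms carry the factor eta. *)
Lemma mulr_le_weighted_sqr (eta x y : R) : 0 < eta ->
  x * y <= eta * x ^+ 2 + eta^-1 * y ^+ 2.
Proof.
move=> e0; rewrite -(ler_pM2l e0) mulrDr [in leRHS]mulrA.
rewrite [eta * (eta^-1 * _)]mulrA divff ?gt_eqF// mul1r.
have := sqr_ge0 (eta * x - y); have := sqr_ge0 (eta * x); have := sqr_ge0 y; nra.
Qed.

(** For a test function [psi], psi' theta(psi) is the derivative of Theta(psi). Since theta is
    bounded by delta and 1-Lipschitz, replacing [psi] by [u] costs an error controlled by the H^1
    distance. *)
Lemma Rintegral_derive_comp0 L u w (delta : R) : 0 < L -> 0 < delta -> H10 L u w ->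
  Rintegral mu (Iv L) (fun x => w x * Num.max 0 (delta - `|u x|)) = 0.
Proof.
move=> L0 d0 uw; have [[u2 [w2 _]] _] := uw.
pose th (s : R) : R := Num.max 0 (delta - `|s|).
have cth : continuous th.
  move=> x; apply: (@continuous_max R R (cst 0) (fun s => delta - `|s|)).
    exact: cst_continuous.
  by apply: continuousB; [exact: cst_continuous|exact: norm_continuous].
have th0 x : x < - delta \/ delta < x -> th x = 0.
  move=> h; rewrite /th; apply/max_idPl; rewrite subr_le0 ler_normr.
  by case: h => h; apply/orP; [right; rewrite lerNr|left]; exact: ltW.
have dTh := is_derive_Rintegral cth th0.
have [mu_ ui] := (L2P _ _).1 u2; have [mw wi] := (L2P _ _).1 w2.
have mL := @measurable_Iv R L.
have thB s : 0 <= th s <= delta.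
  by rewrite /th; case: (lerP 0 (delta - `|s|)) => h; have := normr_ge0 s; lra.
have thN s : `|th s| <= delta by have /andP[s0 s1] := thB s; rewrite ger0_norm.
have thL s t : `|th s - th t| <= `|t - s|.
  have := lerB_dist t s; have := lerB_dist s t; rewrite [`|s - t|]distrC.
  by rewrite /th; case: (lerP 0 (delta - `|s|)) => hs; case: (lerP 0 (delta - `|t|)) => ht h1 h2;
    rewrite ler_norml; apply/andP; split; have := normr_ge0 (t - s); lra.
have mth : measurable_fun (Iv L) (fun x => th (u x)).
  by apply: measurableT_comp => //; exact: continuous_measurable_fun.
have wthi : int L (fun x => w x * th (u x)).
  by apply: (integrable_mulr_bounded (B := delta)) => //; exact: L2_integrable.
set I := Rintegral mu (Iv L) _.
pose C := Rintegral mu (Iv L) (fun x => delta ^+ 2 + w x ^+ 2).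
have Ci : int L (fun x => delta ^+ 2 + w x ^+ 2).
  apply: integrable_funD => //.
  by apply: integrable_continuous; exact: cst_continuous.
have C0 : 0 <= C by apply: Rintegral_ge0 => x _; rewrite addr_ge0 ?sqr_ge0.
have bound eta : 0 < eta -> `|I| <= eta * (C + 1).
  move=> eta0; have [psi tpsi psie] := H10_approx uw (exprn_gt0 2 eta0).
  have cpsi := test_fun_continuous tpsi; have cpsi' := test_fun_continuous_derive1 tpsi.
  have d2 := L2B (L2_continuous L cpsi) u2; have d2' := L2B (L2_continuous L cpsi') w2.
  have {d2} di := L2_sqr d2; have {d2'} di' := L2_sqr d2'.
  have cthpsi : continuous (fun x => derive1 psi x * th (psi x)).
    move=> x; apply: continuousM; first exact: cpsi'.
    by apply: continuous_comp; [exact: cpsi|exact: cth].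
  have ipsi : int L (fun x => derive1 psi x * th (psi x)) by exact: integrable_continuous.
  have Ipsi : Rintegral mu (Iv L) (fun x => derive1 psi x * th (psi x)) = 0.
    have dF (x : R) : is_derive x 1 (fun x => Rintegral mu `]-oo, psi x] th)
        (derive1 psi x * th (psi x)).
      have := is_derive1_comp (dTh (psi x)) (test_fun_is_derive tpsi x).
      by rewrite mulrC.
    rewrite (Rintegral_derive L0 dF cthpsi).
    (* Theta(psi) need not vanish at the endpoints; it equals Theta(0) at both. *)
    by have [-> ->] := test_fun_boundary tpsi; rewrite subrr.
  rewrite -[I]subr0 -Ipsi -RintegralB//.
  apply: le_trans (le_normr_Rintegral _ _) _ => //; first exact: integrable_funB.
  have key x : `|w x * th (u x) - derive1 psi x * th (psi x)| <=
     eta * (delta ^+ 2 + w x ^+ 2) + eta^-1 * ((psi x - u x) ^+ 2 + (derive1 psi x - w x) ^+ 2).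
    (* The splitting pairs the derivative error with the bounded factor theta(psi), and [w] with the
       Lipschitz increment of theta. *)
    have -> : w x * th (u x) - derive1 psi x * th (psi x) =
        (w x - derive1 psi x) * th (psi x) + w x * (th (u x) - th (psi x)) by ring.
    rewrite (le_trans (ler_normD _ _))// !normrM.
    have h1 : `|w x - derive1 psi x| * `|th (psi x)| <= delta * `|derive1 psi x - w x|.
      by rewrite mulrC distrC ler_wpM2r.
    have h2 : `|w x| * `|th (u x) - th (psi x)| <= `|w x| * `|psi x - u x|.
      by rewrite ler_wpM2l.
    have := mulr_le_weighted_sqr delta `|derive1 psi x - w x| eta0.
    have := mulr_le_weighted_sqr `|w x| `|psi x - u x| eta0.
    rewrite !real_normK ?num_real// => h3 h4; rewrite !mulrDr; lra.
  have dii := integrable_funD mL di di'.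
  apply: (@le_trans _ _ (Rintegral mu (Iv L) (fun x => eta * (delta ^+ 2 + w x ^+ 2) +
      eta^-1 * ((psi x - u x) ^+ 2 + (derive1 psi x - w x) ^+ 2)))).
    apply: le_Rintegral => //.
      by apply: integrable_norm; exact: integrable_funB.
    by apply: integrable_funD => //; exact: integrable_funZ.
  rewrite RintegralD//; [|exact: integrable_funZ..].
  rewrite !RintegralZl// (RintegralD _ di di')// -/C [leRHS]mulrDr mulr1 lerD2l.
  by rewrite ler_pdivrMl// -expr2.
apply/eqP; rewrite -normr_le0 leNgt; apply/negP => I0.
have C1 : 0 < C + 1 by rewrite ltr_wpDl.
(* This eta turns the bound into |I| <= |I| / 2. *)
have := bound (`|I| / (C + 1) / 2).
rewrite !divr_gt0// => /(_ isT).
rewrite mulrAC divfK ?gt_eqF//; lra.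
Qed.

End H10.

(** * Decay of H^1_0 functions near the endpoint 0 *)

Section Boundary.
Context {R : realType}.
Local Notation mu := (@lebesgue_measure R).
Implicit Types (L : R) (f g h u w : R -> R).
Local Notation int L f := (mu.-integrable (Iv L) (EFin \o f)).

Lemma sub_Iv (e L : R) : e <= L -> Iv e `<=` Iv L.
Proof. by move=> eL x; rewrite /Iv/= !in_itv/= => /andP[-> /lt_le_trans]; exact. Qed.

Lemma le_Rintegral_Iv (e L : R) f : e <= L -> int L f -> (forall x, 0 <= f x) ->
  Rintegral mu (Iv e) f <= Rintegral mu (Iv L) f.
Proof.
move=> eL fi f0; have sub := sub_Iv eL.
have fie : int e f by apply: integrableS fi => //; exact: measurable_Iv.
rewrite fine_le ?integrable_fin_num//; [exact: measurable_Iv..|].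
apply: ge0_subset_integral => //; [exact: measurable_Iv..|exact: measurable_int fi|].
by move=> x _; rewrite lee_fin.
Qed.

(** Bookkeeping for [H10_boundary_bound], with c = e^2: [W], [A], [B] stand for the integrals over
    (0, L) of w^2, (psi - u)^2, (psi' - w)^2, and the primed letters for those over (0, e). *)
Lemma boundary_arith (c r W W' A A' B B' : R) : 0 <= c ->
  W' <= W -> A' <= A -> B' <= B -> 0 <= A -> 0 <= B -> (A + B) * (2 + 16 * c) <= r ->
  16 * c * W' + (2 * A' + 16 * c * B') <= 16 * c * W + r.
Proof.
move=> c0 h1 h2 h3 h4 h5 h6; have h7 := ler_wpM2l c0 h1.
have h8 := ler_wpM2l c0 h3; have h9 := mulr_ge0 c0 h4; lra.
Qed.

(** A Poincaré inequality on (0, e) using only the condition at 0: (x - e) psi^2 vanishes at 0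
    through [psi] and at e through its first factor, so its derivative [F'] integrates to zero. *)
Lemma H10_boundary_bound L u w (e : R) : H10 L u w -> 0 < e < L ->
  Rintegral mu (Iv e) (fun x => u x ^+ 2) <=
  16 * e ^+ 2 * Rintegral mu (Iv L) (fun x => w x ^+ 2).
Proof.
move=> uw /andP[e0 eL]; have [[u2 [w2 _]] _] := uw.
have L0 := lt_trans e0 eL; have sub := sub_Iv (ltW eL).
have me := @measurable_Iv R e; have mL := @measurable_Iv R L.
have res f : int L f -> int e f by exact: integrableS.
apply/ler_addgt0Pr => r r0.
(* The sum of the coefficients of the two error terms in [key]; an approximation within r / k keeps
   their contribution below r. *)
pose k := 2 + 16 * e ^+ 2; have k0 : 0 < k by rewrite ltr_pwDl// mulr_ge0// sqr_ge0.
have [psi tpsi psie] := H10_approx uw (divr_gt0 r0 k0).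
have cpsi := test_fun_continuous tpsi; have cpsi' := test_fun_continuous_derive1 tpsi.
have di := L2_sqr (L2B (L2_continuous L cpsi) u2).
have di' := L2_sqr (L2B (L2_continuous L cpsi') w2).
have wi := L2_sqr w2; have ui := L2_sqr u2.
pose F' x := psi x ^+ 2 + 2 * (x - e) * (psi x * derive1 psi x).
have cF' : continuous F'.
  rewrite /F' => x; apply: cvgD; first by apply: cvgM; exact: cpsi.
  apply: cvgM; last by apply: cvgM; [exact: cpsi|exact: cpsi'].
  apply: cvgM; first exact: cvg_cst.
  by apply: cvgB; [exact: cvg_id|exact: cvg_cst].
have dF (x : R) : is_derive x 1 (fun x => (x - e) * psi x ^+ 2) (F' x).
  have dp := test_fun_is_derive tpsi x.
  have := is_deriveM (is_deriveB (is_derive_id x 1) (is_derive_cst e x 1)) (is_deriveM dp dp).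
  move=> h; apply: (is_derive_eq h).
  by rewrite /F' /GRing.scale/= subr0 mulr1 !fctE; ring.
have IF' : Rintegral mu (Iv e) F' = 0.
  rewrite (Rintegral_derive e0 dF cF') subrr mul0r.
  by have [-> _] := test_fun_boundary tpsi; rewrite expr0n mulr0 subrr.
have F'i : int e F' by exact: integrable_continuous.
have key x : Iv e x -> u x ^+ 2 <= 4 * F' x + (16 * e ^+ 2 * w x ^+ 2 +
    (2 * (psi x - u x) ^+ 2 + 16 * e ^+ 2 * (derive1 psi x - w x) ^+ 2)).
  rewrite /Iv/= in_itv/= => /andP[x0 xe]; rewrite /F'.
  set p := psi x; set p' := derive1 psi x; rewrite -subr_ge0.
  (* The squares add up three estimates: u^2 <= 2 p^2 + 2 (p - u)^2, then 2 p^2 <= 4 F' + 8 e^2 p'^2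
     since |x - e| <= e, then p'^2 <= 2 w^2 + 2 (p' - w)^2. Hence the constants 4 and 16. *)
  rewrite (_ : _ - _ = (2 * p - u x) ^+ 2 + 2 * (p + 2 * (x - e) * p') ^+ 2 +
    8 * ((e - (x - e)) * (e + (x - e))) * p' ^+ 2 + 8 * e ^+ 2 * (2 * w x - p') ^+ 2); last by ring.
  have h : 0 <= (e - (x - e)) * (e + (x - e)) by apply: mulr_ge0; lra.
  by do 3 ?[apply: addr_ge0]; rewrite ?sqr_ge0// mulr_ge0 ?sqr_ge0// mulr_ge0 ?sqr_ge0.
apply: (@le_trans _ _ (Rintegral mu (Iv e) (fun x => 4 * F' x + (16 * e ^+ 2 * w x ^+ 2 +
    (2 * (psi x - u x) ^+ 2 + 16 * e ^+ 2 * (derive1 psi x - w x) ^+ 2))))).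
  apply: le_Rintegral => //; first exact: res.
  apply: integrable_funD => //; first exact: integrable_funZ.
  apply: integrable_funD => //; first by apply: integrable_funZ => //; exact: res.
  by apply: integrable_funD => //; apply: integrable_funZ => //; exact: res.
have die := res _ di; have die' := res _ di'; have wie := res _ wi.
have i1 := integrable_funZ me (16 * e ^+ 2) wie.
have i2 := integrable_funZ me 2 die.
have i3 := integrable_funZ me (16 * e ^+ 2) die'.
rewrite RintegralD//; last first.
- by apply: integrable_funD => //; exact: integrable_funD.
- exact: integrable_funZ.
rewrite RintegralD//; last exact: integrable_funD.
rewrite RintegralD// !RintegralZl// IF' mulr0 add0r.
have h1 := le_Rintegral_Iv (ltW eL) wi (fun x => sqr_ge0 _).
have h2 := le_Rintegral_Iv (ltW eL) di (fun x => sqr_ge0 _).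
have h3 := le_Rintegral_Iv (ltW eL) di' (fun x => sqr_ge0 _).
have h4 : 0 <= Rintegral mu (Iv L) (fun x => (psi x - u x) ^+ 2).
  by apply: Rintegral_ge0 => x _; exact: sqr_ge0.
have h5 : 0 <= Rintegral mu (Iv L) (fun x => (derive1 psi x - w x) ^+ 2).
  by apply: Rintegral_ge0 => x _; exact: sqr_ge0.
by move: psie; rewrite ler_pdivlMr//; exact: boundary_arith (sqr_ge0 e) h1 h2 h3 h4 h5.
Qed.

End Boundary.

(** * Almost everywhere comparisons and extended-valued L^2 functions *)

Section AlmostEverywhere.
Context {R : realType}.
Local Notation mu := (@lebesgue_measure R).
Implicit Types (L : R) (f g : R -> R).
Local Notation int L f := (mu.-integrable (Iv L) (EFin \o f)).

Lemma Rintegral_ae_eq L f g : measurable_fun (Iv L) f -> measurable_fun (Iv L) g ->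
  {ae mu, forall x, Iv L x -> f x = g x} ->
  Rintegral mu (Iv L) f = Rintegral mu (Iv L) g.
Proof.
move=> mf mg fg; congr fine; apply: ae_eq_integral.
- exact: measurable_Iv.
- exact/measurable_EFinP.
- exact/measurable_EFinP.
- by apply: ae_imply fg => x h Lx; rewrite h.
Qed.

Lemma Rintegral_ge0_eq0 L f : int L f ->
  {ae mu, forall x, Iv L x -> 0 <= f x} -> Rintegral mu (Iv L) f = 0 ->
  {ae mu, forall x, Iv L x -> f x = 0}.
Proof.
move=> fi f0 If; have mL := @measurable_Iv R L; have mf := measurable_int _ fi.
have : ae_eq mu (Iv L) (EFin \o f) (cst 0%E).
  apply/(ae_eq_integral_abs mu mL mf).
  have ni := integrable_norm fi.
  rewrite -[LHS](fineK (integrable_fin_num mL ni)) -[RHS]/(0%:E); congr EFin.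
  rewrite -[RHS]If; apply: Rintegral_ae_eq.
  - by apply/measurable_EFinP; exact: measurable_int ni.
  - exact/measurable_EFinP.
  - by apply: ae_imply f0 => x h Lx /=; rewrite ger0_norm// h.
by apply: ae_imply => x h Lx; have := h Lx => -[].
Qed.

Lemma ae_ge_Rintegral L f (c : R) : 0 < L -> int L f -> 0 <= c -> (forall x, 0 <= f x) ->
  {ae mu, forall x, Iv L x -> c <= f x} ->
  c * L <= Rintegral mu (Iv L) f.
Proof.
move=> L0 fi c0 f0 cf; have mL := @measurable_Iv R L; have mf := measurable_int _ fi.
rewrite -lee_fin fineK; last exact: integrable_fin_num.
have -> : (c * L)%:E = (\int[mu]_(x in Iv L) c%:E)%E.
  rewrite integral_cst//.
  rewrite -[X in (_ * X)%E]/(mu (Iv L)) /Iv lebesgue_measure_itv/= lte_fin L0.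
  by rewrite sube0 EFinM.
apply: ae_ge0_le_integral => //.
- by move=> x _; rewrite lee_fin.
Qed.

(** [fine] sends infinite values to 0, so the square can only decrease. *)
Lemma L2e_fine L (phi : R -> \bar R) : L2e L phi -> L2 L (fun x => fine (phi x)).
Proof.
move=> [mp pi]; have mf : measurable_fun (Iv L) (fun x => fine (phi x)).
  by apply: measurableT_comp mp => //; exact: fine_measurable.
split => //; apply: le_lt_trans pi; apply: ge0_le_integral => //.
- exact: measurable_Iv.
- by move=> x _; rewrite lee_fin sqr_ge0.
- by apply/measurable_EFinP; exact: measurable_funX.
- exact: emeasurable_funM.
- by move=> x _; case: (phi x) => [r||] //=; rewrite -?EFinM -?expr2 ?expr0n ?leey.
Qed.

(** An infinite value of [phi] makes [phi x * phi x] equal to +oo, which an integrable function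
    takes only on a null set. *)
Lemma L2e_ae_lty L (phi : R -> \bar R) : L2e L phi ->
  {ae mu, forall x, Iv L x -> (phi x < +oo)%E}.
Proof.
move=> [mp pi]; have mL := @measurable_Iv R L.
have pp x : (0 <= phi x * phi x)%E.
  by case: (phi x) => [r||] //=; rewrite -EFinM lee_fin -expr2 sqr_ge0.
have : mu.-integrable (Iv L) (fun x => phi x * phi x)%E.
  apply/integrableP; split; first exact: emeasurable_funM.
  by under eq_integral do rewrite gee0_abs//.
move=> /(integrable_ae mL); apply: ae_imply => x h Lx; have := h Lx.
by case: (phi x) => [r||] //=; rewrite ltry.
Qed.
End AlmostEverywhere.

Unset Implicit Arguments. Set Strict Implicit. Set Printing Implicit Defensive.

Theorem theorem4p1 (R : realType) (L : R) (a g : R -> R) (phi : R -> \bar R)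
    (alpha beta M : R) :
  0 < L ->
  (* (H_a) *)
  0 < alpha -> alpha < beta ->
  measurable_fun (Iv L) a ->
  {ae (@lebesgue_measure R), forall x, Iv L x -> alpha <= a x <= beta} ->
  (* g in L^2 *)
  L2 L g ->
  (* (H_phi): phi : R -> R u {+oo} continuous, finite off 0 *)
  (forall s, (-oo < phi s)%E) ->
  continuous phi ->
  (forall s, s != 0 -> (phi s < +oo)%E) ->
  phi 0 = +oo%E ->
  (* g >= -M a.e. *)
  0 < M ->
  {ae (@lebesgue_measure R), forall x, Iv L x -> - M <= g x} ->
  ~ exists u : R -> R, weak_solution L a g phi u.
Proof.
move=> L0 al0 alb ma Ha g2 phiN cphi phi_lt phi0 M0 gM [u [w [uw [phi2 weak]]]].
have [[u2 [w2 _]] _] := uw.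
have mL := @measurable_Iv R L.
have [mw _] := w2.
(* The bounds on [a] hold only a.e., whereas [L2_mul_bounded] asks for them at every point; the
   truncation agrees with [a] a.e. *)
pose a0 x := Num.min (Num.max (a x) alpha) beta.
have a0E x : alpha <= a x <= beta -> a0 x = a x.
  by move=> /andP[h1 h2]; rewrite /a0 (max_idPl h1) (min_idPl h2).
have ma0 : measurable_fun (Iv L) a0.
  by apply: measurable_minr; [apply: measurable_maxr|].
have a0B x : `|a0 x| <= beta.
  have be0 := lt_trans al0 alb.
  by rewrite ler_norml ge_min lexx orbT andbT le_min le_max; apply/andP; split;
    [apply/orP; right|]; lra.
pose p x := fine (phi (u x)).
have p2 : L2 L p := L2e_fine phi2.
have a0w2 : L2 L (fun x => a0 x * w x) by exact: (L2_mul_bounded (B := beta)).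
pose h x := a0 x * w x - p x - g x.
have hi : lebesgue_measure.-integrable (Iv L) (EFin \o h).
  by apply: L2_integrable; exact: L2B (L2B a0w2 p2) g2.
have hpsi psi : test_fun L psi ->
    Rintegral lebesgue_measure (Iv L) (fun x => h x * derive1 psi x) = 0.
  move=> tpsi; have cpsi' := test_fun_continuous_derive1 tpsi.
  have pgi := integrable_funD mL (L2_integrable p2) (L2_integrable g2).
  have i1 := integrable_mulr_continuous L0 (L2_integrable a0w2) cpsi'.
  have i2 := integrable_mulr_continuous L0 pgi cpsi'.
  transitivity (Rintegral lebesgue_measure (Iv L) (fun x => a0 x * w x * derive1 psi x -
      (p x + g x) * derive1 psi x)).
    by apply: eq_Rintegral => x _; rewrite /h; ring.
  rewrite RintegralB// -(weak _ tpsi); apply/eqP; rewrite subr_eq0; apply/eqP.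
  have mpsi' : measurable_fun (Iv L) (derive1 psi) by exact: measurable_continuous.
  apply: Rintegral_ae_eq.
  - by apply: measurable_funM => //; exact: measurable_funM.
  - by apply: measurable_funM => //; exact: measurable_funM.
  - by apply: ae_imply Ha => x ax Lx; rewrite a0E// ax.
have [C hC] := du_bois_reymond L0 hi hpsi.
(* The threshold is set so that phi(u) > M - C + 1 and g >= -M give C + phi(u) + g > 1. *)
have [delta d0 phid] : exists2 delta, 0 < delta & forall s, `|s| < delta ->
    ((M - C + 1)%:E < phi s)%E.
  have := cphi 0; rewrite /continuous_at phi0 => /cvgey_gt/(_ (M - C + 1)).
  move=> /nbhs_ballP[d d0 hd]; exists d => // s sd; apply: hd.
  by rewrite /ball/= sub0r normrN.
have wpos : {ae (@lebesgue_measure R), forall x, Iv L x -> `|u x| < delta -> 0 < w x}.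
  apply: ae_imply2 _ (ae_conj hC (L2e_ae_lty phi2)) (ae_conj Ha gM).
  move=> x [hx px] [ax gx] Lx ux; move: (hx Lx) (px Lx) (ax Lx) (gx Lx) (phid _ ux).
  rewrite /h => {hx px ax gx} hx px ax gx; rewrite a0E// in hx; rewrite /p in hx.
  (* Finiteness matters: at +oo, [fine] would return 0 and the lower bound on [phi] would not reach
     the equation. *)
  have fp : phi (u x) \is a fin_num by rewrite fin_numElt phiN px.
  rewrite -(fineK fp) lte_fin => Kx; have /andP[aalpha _] := ax.
  rewrite -(pmulr_rgt0 _ (lt_le_trans al0 aalpha)); lra.
have uge : {ae (@lebesgue_measure R), forall x, Iv L x -> delta ^+ 2 <= u x ^+ 2}.
  have mth : measurable_fun (Iv L) (fun x => Num.max 0 (delta - `|u x|)).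
    apply: measurable_maxr; first exact: measurable_cst.
    apply: measurable_funB; first exact: measurable_cst.
    by apply: measurableT_comp => //; case: u2.
  have thi : lebesgue_measure.-integrable (Iv L)
      (EFin \o (fun x => w x * Num.max 0 (delta - `|u x|))).
    apply: (integrable_mulr_bounded (B := delta)) => //; first exact: L2_integrable.
    move=> x _; rewrite ger0_norm ?le_max ?lexx// ge_max (ltW d0)/=.
    by rewrite gerBl.
  have := Rintegral_ge0_eq0 thi _ (Rintegral_derive_comp0 L0 d0 uw).
  have th0 : {ae (@lebesgue_measure R), forall x, Iv L x -> 0 <= w x * Num.max 0 (delta - `|u x|)}.
    apply: ae_imply wpos => x wx Lx; have [du|ud] := leP delta `|u x|.
      by rewrite (max_idPl _) ?mulr0// subr_le0.
    by rewrite mulr_ge0 ?le_max ?lexx// ltW// wx.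
  move=> /(_ th0); apply: ae_imply2 wpos => x wx hx Lx.
  rewrite -[u x ^+ 2]real_normK ?num_real// lerXn2r ?nnegrE ?(ltW d0)// leNgt.
  apply/negP => ud; have /eqP := hx Lx; rewrite mulf_eq0 gt_eqF ?wx//=.
  by rewrite (max_idPr _) ?subr_ge0 ?ltW// gt_eqF// subr_gt0.
pose W := Rintegral lebesgue_measure (Iv L) (fun x => w x ^+ 2).
have W0 : 0 <= W by apply: Rintegral_ge0 => x _; exact: sqr_ge0.
(* Comparing delta^2 e with 16 e^2 W and dividing by e leaves a right side that tends to 0 with
   e. *)
have bound e : 0 < e < L -> delta ^+ 2 <= 16 * e * W.
  move=> eL; have /andP[e0 /ltW le_eL] := eL.
  have ue : lebesgue_measure.-integrable (Iv e) (EFin \o (fun x => u x ^+ 2)).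
    by apply: integrableS (L2_sqr u2) => //; [exact: measurable_Iv|exact: sub_Iv].
  have uge' : {ae (@lebesgue_measure R), forall x, Iv e x -> delta ^+ 2 <= u x ^+ 2}.
    by apply: ae_imply uge => x ux /(sub_Iv le_eL)/ux.
  have := le_trans (ae_ge_Rintegral e0 ue (sqr_ge0 _) (fun x => sqr_ge0 _) uge')
    (H10_boundary_bound uw eL).
  by rewrite -/W expr2 -[16 * _ * W]mulrA [e * e * W]mulrAC !mulrA ler_pM2r// mulrAC.
have W1 : 0 < W + 1 by rewrite ltr_wpDl.
(* The second entry gives 32 e (W + 1) <= delta^2 <= 16 e W, impossible for e > 0; the summand 1
   keeps the denominator positive when W = 0, and L / 2 ensures e < L. *)
pose e := Num.min (L / 2) (delta ^+ 2 / (32 * (W + 1))).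
have d2 : 0 < delta ^+ 2 by rewrite exprn_gt0.
have e0 : 0 < e by rewrite lt_min !divr_gt0 ?mulr_gt0.
have eL : e < L by rewrite gt_min ltr_pdivrMr// ltr_pMr// ltr1n.
have : e * (32 * (W + 1)) <= delta ^+ 2.
  by rewrite -ler_pdivlMr ?mulr_gt0// ge_min lexx orbT.
have := bound e; rewrite e0 eL => /(_ isT); have := mulr_ge0 (ltW e0) W0; lra.
Qed.
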